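(* Let $S$ be a monoid. A right $S$-act $Q$ is InC-injective if and only if it is injective relative to all inclusions into cyclic acts, i.e. if and only if for every cyclic right $S$-act $B$, every subact $C\subseteq B$ and every homomorphism $f:C\to Q$ there is a homomorphism $\overline f:B\to Q$ with $\overline f|_C=f$.
   Context: $S$ is a monoid with identity $1$. A right $S$-act is a non-empty set $A$ with a unitary right action of $S$, i.e. $(as)t=a(st)$ and $a1=a$. Subacts are non-empty subsets closed under the action; homomorphisms are maps commuting with the action. An act is cyclic if it is of the form $bS$ for some element $b$. An act is decomposable if it is the union of two disjoint (non-empty) subacts, and indecomposable otherwise. An act $Q$ is InC-injective (indecomposable codomain injective) if for every indecomposable act $B$, every subact $C\subseteq B$ and every homomorphism $f:C\to Q$ there is a homomorphism $\overline f:B\to Q$ with $\overline f|_C=f$. *)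

(* Defs.v *)
From HB Require Import structures.
From mathcomp Require Import all_boot.
From mathcomp Require Import boolp classical_sets.

Set Implicit Arguments.
Unset Strict Implicit.
Unset Printing Implicit Defensive.

Local Open Scope classical_set_scope.

HB.mixin Record isRAct (S : monoidType) (A : Type) := {
  ract : A -> S -> A;
  ractA : forall a s t, ract (ract a s) t = ract a (s * t)%g;
  ract1 : forall a, ract a 1%g = a;
  ract_inhabited : inhabited A
}.

#[short(type="ractType")]
HB.structure Definition RAct (S : monoidType) := { A of isRAct S A }.

Definition is_subact (S : monoidType) (A : ractType S) (C : set A) : Prop :=
  C !=set0 /\ forall a (s : S), C a -> C (ract a s).

Record subactType (S : monoidType) (A : ractType S) := Subact {
  subact_set :> set A;
  subactP : is_subact subact_set
}.

(* A subact C is itself an act, carried by the subtype [set_type C], to which C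
   coerces: a map C -> Q below is defined on C only. *)
Section SubactAct.
Context (S : monoidType) (A : ractType S) (C : subactType A).

Lemma subact_ract_subproof (c : C) (s : S) : ract (val c) s \in (C : set A).
Proof. by apply/mem_set/(subactP C).2/set_mem/valP. Qed.

Definition subact_ract (c : C) (s : S) : C :=
  exist _ (ract (val c) s) (subact_ract_subproof c s).

Lemma subact_ractA c s t :
  subact_ract (subact_ract c s) t = subact_ract c (s * t)%g.
Proof. by apply: val_inj; rewrite /= ractA. Qed.

Lemma subact_ract1 c : subact_ract c 1%g = c.
Proof. by apply: val_inj; rewrite /= ract1. Qed.

Lemma subact_inhabited : inhabited C.
Proof.
by have [[a Ca] _] := subactP C; exact: (inhabits (exist _ a (mem_set Ca))).
Qed.

HB.instance Definition _ :=
  isRAct.Build S (set_type C) subact_ractA subact_ract1 subact_inhabited.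

End SubactAct.

Definition act_hom (S : monoidType) (A B : ractType S) (f : A -> B) : Prop :=
  forall (a : A) (s : S), f (ract a s) = ract (f a) s.

Definition cyclic_act (S : monoidType) (A : ractType S) : Prop :=
  exists b : A, [set: A] = [set ract b s | s in [set: S]].

Definition decomposable (S : monoidType) (A : ractType S) : Prop :=
  exists B C : set A,
    [/\ is_subact B, is_subact C, B `&` C = set0 & [set: A] = B `|` C].

Definition indecomposable (S : monoidType) (A : ractType S) : Prop :=
  ~ decomposable A.

Definition injective_into (S : monoidType) (Q B : ractType S) : Prop :=
  forall (C : subactType B) (f : C -> Q), act_hom f ->
    exists2 fbar : B -> Q, act_hom fbar & forall c : C, fbar (val c) = f c.

Definition InC_injective (S : monoidType) (Q : ractType S) : Prop :=
  forall B : ractType S, indecomposable B -> injective_into Q B.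

(* Main.v *)
Require Import Defs.
From mathcomp Require Import all_boot.
From mathcomp Require Import boolp classical_sets.

Set Implicit Arguments.
Unset Strict Implicit.
Unset Printing Implicit Defensive.

Local Open Scope classical_set_scope.

(** Cyclic acts are indecomposable: the block that contains the generator [b]
    contains all of [bS]. So an InC-injective act is injective into cyclic acts.

    Conversely, let [f : C -> Q] be defined on a subact of an indecomposable
    act [B]. By Zorn's lemma ([maximal_extension]) [f] extends to a homomorphism
    [g : D -> Q] whose domain cannot be enlarged. If [D] met a cyclic subact
    [bS], then injectivity into [bS] would extend the restriction of [g] to
    [D `&` bS], and glueing would extend [g] to [D `|` bS]; by maximality [b]
    is in [D] ([maximal_orbit]). Thus an element outside [D] never enters [D]
    under the action: the complement of [D] is empty or a subact. In the second
    case [B] would be the disjoint union of [D] and its complement, so [D] is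
    all of [B].

    Partial homomorphisms are handled through their graphs, since the union of
    a chain and the glueing of two of them are then plain unions of sets. *)

Definition to_set_type (T : Type) (C : set T) (x : T) (Cx : C x) : C :=
  exist _ x (mem_set Cx).

Lemma cyclic_indecomposable (S : monoidType) (A : ractType S) :
  cyclic_act A -> indecomposable A.
Proof.
move=> [b Ab] [B [C [[[x Bx] BS] [[y Cy] CS] BC0 ABC]]].
have gen z : exists s, ract b s = z.
  by have: [set: A] z by []; rewrite Ab => -[s _ <-]; exists s.
have disj z : B z -> C z -> False.
  by move=> Bz Cz; have : (B `&` C) z by []; rewrite BC0.
have : [set: A] b by [].
rewrite ABC => -[Bb|Cb].
  by have [s sy] := gen y; apply: (disj y) => //; rewrite -sy; apply: BS.
by have [s sx] := gen x; apply: (disj x) => //; rewrite -sx; apply: CS.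
Qed.

Section PartialHom.
Context (S : monoidType) (A Q : ractType S).
Implicit Types (G H : set (A * Q)).

Definition single_valued G := forall a p q, G (a, p) -> G (a, q) -> p = q.

Definition stable G := forall a q s, G (a, q) -> G (ract a s, ract q s).

Definition partial_hom G := single_valued G /\ stable G.

Definition dom G : set A := [set a | exists q, G (a, q)].

Definition graph_along (M : Type) (i : M -> A) (f : M -> Q) : set (A * Q) :=
  [set (i m, f m) | m in [set: M]].

Lemma stable_graph_along (M : ractType S) (i : M -> A) (f : M -> Q) :
  act_hom i -> act_hom f -> stable (graph_along i f).
Proof.
by move=> ih fh a q s [m _ [<- <-]]; exists (ract m s); rewrite // ih fh.
Qed.

Lemma single_valued_graph_along (M : Type) (i : M -> A) (f : M -> Q) :
  injective i -> single_valued (graph_along i f).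
Proof.
by move=> ii a p q [m _ [<- <-]] [n _ [/ii -> ->]].
Qed.

Lemma stableU G H : stable G -> stable H -> stable (G `|` H).
Proof.
by move=> sG sH a q s [/sG|/sH] h; [left|right]; apply: h.
Qed.

Lemma is_subact_dom G : stable G -> dom G !=set0 -> is_subact (dom G).
Proof. by move=> sG D0; split=> // a s [q /sG aq]; exists (ract q s). Qed.

(** Evaluates a partial homomorphism along any homomorphism into its domain. The
    freedom in [i] covers both the full act and a subact of a subact. *)
Lemma hom_of_partial_hom G (M : ractType S) (i : M -> A) :
    partial_hom G -> act_hom i -> (forall m, dom G (i m)) ->
  exists2 g : M -> Q, act_hom g & forall m, G (i m, g m).
Proof.
move=> [vG sG] ih /choice[g gG]; exists g => // m s.
by apply: vG (gG _) _; rewrite ih; apply: sG.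
Qed.

Definition maximal_partial_hom G :=
  partial_hom G /\ forall H, partial_hom H -> G `<=` H -> H `<=` G.

(** Zorn's lemma is applied to the sets [X] such that [X `|` G] is a partial
    homomorphism, rather than to those that contain [G], so that the union of
    the empty chain qualifies. *)
Lemma maximal_extension G : partial_hom G ->
  exists2 H, maximal_partial_hom H & G `<=` H.
Proof.
move=> pG; pose P X := partial_hom (X `|` G).
have [|X [PX maxX]] := @Zorn_bigcup _ P.
  move=> F FP totF.
  have in_chain X : F X -> partial_hom (X `|` G) by move/FP.
  split.
    move=> a p q [[X FX Xp]|Gp] [[Y FY Yq]|Gq].
    - have [XY|YX] := totF _ _ FX FY.
        by apply: (in_chain _ FY).1; left; [apply: XY Xp|exact: Yq].
      by apply: (in_chain _ FX).1; left; [exact: Xp|apply: YX Yq].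
    - by apply: (in_chain _ FX).1; [left; exact: Xp|right].
    - by apply: (in_chain _ FY).1; [right; exact: Gp|left].
    - exact: pG.1 Gp Gq.
  move=> a q s [[X FX Xq]|Gq]; last by right; apply: pG.2.
  have [||Gs] := (in_chain _ FX).2 a q s; first by left.
  - by move=> Xs; left; exists X.
  - by right.
exists (X `|` G); last by right.
split=> // H pH XGH.
apply: contrapT => HXG; apply: (maxX H); last first.
  by rewrite /P setUidl // => z Gz; apply: XGH; right.
by split=> [z Xz|HX]; [apply: XGH; left|apply: HXG => z /HX; left].
Qed.

End PartialHom.

Definition orbit (S : monoidType) (A : ractType S) (b : A) : set A :=
  [set ract b s | s in [set: S]].

Lemma is_subact_orbit (S : monoidType) (A : ractType S) (b : A) :
  is_subact (orbit b).
Proof.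
split=> [|_ s [t _ <-]]; first by exists (ract b 1%g); exists 1%g.
by exists (t * s)%g; rewrite // ractA.
Qed.

Lemma orbit_refl (S : monoidType) (A : ractType S) (b : A) : orbit b b.
Proof. by exists 1%g; rewrite // ract1. Qed.

Lemma cyclic_orbit (S : monoidType) (A : ractType S) (b : A) :
  cyclic_act (Subact (is_subact_orbit b)).
Proof.
exists (to_set_type (orbit_refl b)).
apply/seteqP; split=> // -[x xb] _.
by have [s _ sx] := set_mem xb; exists s => //; apply: val_inj.
Qed.

Section InjectiveIntoCyclic.
Context (S : monoidType) (Q : ractType S).
Context (cycQ : forall B : ractType S, cyclic_act B -> injective_into Q B).
Context (B : ractType S).

(** A maximal partial homomorphism already contains the extension to [bS] of its
    restriction to the part of [bS] in its domain; the element [bs] makes that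
    part non-empty, hence a subact. *)
Lemma maximal_orbit (G : set (B * Q)) (b : B) (s : S) :
  maximal_partial_hom G -> dom G (ract b s) -> dom G b.
Proof.
move=> [pG maxG] Gbs; have [vG sG] := pG.
pose bS : ractType S := Subact (is_subact_orbit b).
have subK : is_subact [set x : bS | dom G (val x)].
  split=> [|x t [q xq]]; last by exists (ract q t); apply: sG.
  have bSs : orbit b (ract b s) by exists s.
  by exists (to_set_type bSs).
pose K := Subact subK.
have [|||g gh gG] := @hom_of_partial_hom _ _ _ G K (fun k => val (val k)).
- by [].
- by [].
- by move=> k; exact: set_mem (valP k).
have [h hh hg] := cycQ (@cyclic_orbit _ _ b) gh.
pose H : set (B * Q) := graph_along (fun x : bS => val x) h.
(* On the common domain [h] agrees with [g], whose graph lies in [G]. *)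
have GH x p q : G (x, p) -> H (x, q) -> p = q.
  move=> Gp [y _ [yx <-]]; have Ky : (K : set bS) y by exists p; rewrite /= yx.
  pose k : K := to_set_type Ky.
  have -> : h y = g k by rewrite -hg.
  by apply: vG Gp _; rewrite -yx; exact: (gG k).
have pGH : partial_hom (G `|` H).
  split; last by apply: stableU => //; apply: stable_graph_along.
  move=> x p q [Gp|Hp] [Gq|Hq].
  - exact: vG Gp Gq.
  - exact: GH Gp Hq.
  - by rewrite (GH _ _ _ Gq Hp).
  - by apply: single_valued_graph_along Hp Hq; exact: val_inj.
pose b0 : bS := to_set_type (orbit_refl b).
exists (h b0); apply: maxG pGH _ _ _; first by left.
by right; exists b0.
Qed.

(** By [maximal_orbit] the complement of the domain is closed under the action,
    so it would split [B] if it were non-empty. *)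
Lemma maximal_total (G : set (B * Q)) : indecomposable B ->
  maximal_partial_hom G -> dom G !=set0 -> forall x, dom G x.
Proof.
move=> indB mG D0 x; apply: contrapT => Dx; apply: indB.
exists (dom G), (~` dom G); split.
- exact: is_subact_dom mG.1.2 D0.
- by split=> [|a s Da /(maximal_orbit mG)]; first by exists x.
- exact: setICr.
- by rewrite setUCr.
Qed.

Lemma injective_into_indecomposable : indecomposable B -> injective_into Q B.
Proof.
move=> indB C f fh; pose Gf := graph_along (fun c : C => val c) f.
have pGf : partial_hom Gf.
  split; last exact: stable_graph_along.
  by apply: single_valued_graph_along; exact: val_inj.
have [G mG GfG] := maximal_extension pGf.
have Gc (c : C) : G (val c, f c) by apply: GfG; exists c.
have D0 : dom G !=set0.
  by have [c] := @ract_inhabited _ C; exists (val c), (f c).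
have [||g gh gG] := @hom_of_partial_hom _ _ _ G B id mG.1.
- by [].
- exact: maximal_total.
by exists g => // c; apply: mG.1.1 (gG _) (Gc c).
Qed.

End InjectiveIntoCyclic.

Theorem corollary2p8 (S : monoidType) (Q : ractType S) :
  InC_injective Q <->
  (forall B : ractType S, cyclic_act B -> injective_into Q B).
Proof.
split=> [injQ B cycB|cycQ B]; last exact: injective_into_indecomposable.
exact/injQ/cyclic_indecomposable.
Qed.
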